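(* Let $\mathcal{P}=\{\mathbb{P}_{\boldsymbol\theta}:\boldsymbol\theta\in\boldsymbol\Theta\}$ with $\boldsymbol\Theta\subseteq\mathbb{R}^p$ be a parametric family and $\mathcal{M}$ an estimation scheme satisfying the uniform tail assumption (stated in the context) with constants $C_1,C_2,\gamma>0$ and $r(n)=n^\kappa$ for some $\kappa>0$. Let $s>0$ and let the sample size schedule satisfy $c_t\asymp t^{\gamma(1+s)/\kappa}$ for $t\ge1$. Let $(\widehat{\boldsymbol\theta}_t)_{t\ge1}$ be the recursive training process (defined in the context) with ground truth $\boldsymbol\theta^\star\in\boldsymbol\Theta$, initial sample size $n$ and schedule $(c_t)_{t\ge1}$. Then for every $\delta>0$, $$\lim_{n\to\infty}\lim_{T\to\infty}\mathbb{P}\big(\|\widehat{\boldsymbol\theta}_T-\boldsymbol\theta^\star\|_2\ge\delta\big)=0.$$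
   Context: Estimation scheme: $\mathcal{M}$ maps any finite dataset of points of the sample space $\mathcal{X}$ to an element of $\boldsymbol\Theta$. Recursive (fully synthetic) training: $\mathcal{D}_0$ consists of $n_0=n$ i.i.d. draws from $\mathbb{P}_{\boldsymbol\theta^\star}$; $\widehat{\boldsymbol\theta}_{t+1}=\mathcal{M}(\mathcal{D}_t)$ for all $t\ge0$; and for $t\ge1$, conditionally on the past, $\mathcal{D}_t$ consists of $n_t=c_t\, n$ i.i.d. draws from $\mathbb{P}_{\widehat{\boldsymbol\theta}_t}$ (if $c_tn$ is not an integer, $n_t=\lceil c_tn\rceil$). Uniform tail assumption: there are constants $C_1,C_2,\gamma>0$ and a positive diverging sequence $r(n)$ such that for all $n\ge1$ and all $\delta>0$, $$\sup_{\boldsymbol\theta\in\boldsymbol\Theta}\mathbb{P}\big(\|\widehat{\boldsymbol\theta}-\boldsymbol\theta\|_2\ge\delta\big)\le C_1\exp(-C_2\,r(n)\,\delta^\gamma),$$ where $\widehat{\boldsymbol\theta}=\mathcal{M}(\mathcal{D})$ and $\mathcal{D}$ consists of $n$ i.i.d. draws from $\mathbb{P}_{\boldsymbol\theta}$. $a_t\asymp b_t$ means there are constants $0<c\le C<\infty$ with $c\,b_t\le a_t\le C\,b_t$ for all $t\ge1$.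
   Formalization: The inner limit over T is replaced by the limit superior over T, because under the stated assumptions the inner limit need not exist for a fixed n; whenever it exists the two agree. *)

(* Defs.v *)
From HB Require Import structures.
From mathcomp Require Import all_boot all_order all_algebra.
From mathcomp Require Import all_classical all_reals all_analysis measurable_realfun.

Set Implicit Arguments.
Unset Strict Implicit.
Unset Printing Implicit Defensive.

Import Order.TTheory GRing.Theory Num.Theory.
Import numFieldNormedType.Exports.

Local Open Scope classical_set_scope.
Local Open Scope ring_scope.

Definition norm2 (R : realType) (p : nat) (x : 'rV[R]_p) : R :=
  Num.sqrt (\sum_(j < p) x ord0 j ^+ 2).

Definition asymp (R : realType) (a b : nat -> R) : Prop :=
  exists c C : R, [/\ 0 < c, c <= C &
    forall t : nat, (1 <= t)%N -> c * b t <= a t /\ a t <= C * b t].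

Section iid.
Context (d : measure_display) (X : measurableType d) (R : realType).

Definition tuple_cons (m : nat) (z : X * m.-tuple X) : m.+1.-tuple X :=
  [tuple of z.1 :: z.2].

Lemma measurable_tuple_cons (m : nat) :
  measurable_fun [set: X * m.-tuple X] (@tuple_cons m).
Proof. exact: measurable_cons. Qed.

HB.instance Definition _ (m : nat) :=
  isMeasurableFun.Build _ _ _ _ (@tuple_cons m) (@measurable_tuple_cons m).

(* The joint law of [m] i.i.d. draws from [mu], i.e. the [m]-fold product
   measure on the product sigma-algebra of [m.-tuple X]. *)
Fixpoint iid_law (mu : probability X R) (m : nat) :
    probability (m.-tuple X) R :=
  match m with
  | 0 => \d_([tuple] : 0.-tuple X)
  | m'.+1 => distribution (mu \x iid_law mu m')%E (@tuple_cons m')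
  end.

Lemma iid_law_rect (mu : probability X R) (m : nat) (A : 'I_m -> set X) :
  (forall i, measurable (A i)) ->
  iid_law mu m [set x | forall i, A i (tnth x i)] =
  (\prod_(i < m) mu (A i))%E.
Proof.
elim: m A => [|m IHm] A mA.
  by rewrite big_ord0 /= diracE mem_set//= => -[].
rewrite big_ord_recl /= /distribution /pushforward /=.
rewrite [X in product_measure1 _ _ X](_ : _ = A ord0 `*`
    [set x : m.-tuple X | forall i, A (lift ord0 i) (tnth x i)]); last first.
  apply/seteqP; split => -[x y] /=.
    move=> H; split; first by have := H ord0; rewrite tnth0.
    by move=> i; have := H (lift ord0 i); rewrite tnthS.
  move=> [H0 H1] i; case: (unliftP ord0 i) => [j|] ->.
    by rewrite tnthS.
  by rewrite tnth0.
rewrite product_measure1E//; first by congr (_ * _)%E;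
  apply: (IHm (fun i => A (lift ord0 i))) => i; exact: mA.
rewrite (_ : [set _ | _] = \bigcap_(i in [set: 'I_m])
  ((fun x : m.-tuple X => tnth x i) @^-1` A (lift ord0 i))); last first.
  by apply/seteqP; split => x H i => [_|]; [exact: H|exact: (H i I)].
apply: fin_bigcap_measurable => // i _.
rewrite -[X in measurable X]setTI; exact: measurable_tnth.
Qed.

End iid.

Section training.
Context (d : measure_display) (X : measurableType d) (R : realType) (p : nat).
Variable Theta : set 'rV[R]_p.

(* A dataset is an ordered tuple, so an estimation scheme may, but need not,
   depend on the order of the observations. *)
Definition estimation_scheme := forall m : nat, m.-tuple X -> Theta.

(* Borel measurability of a map into [R^p], stated on coordinates. *)
Definition measurable_scheme (M : estimation_scheme) : Prop :=
  forall (m : nat) (j : 'I_p),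
    measurable_fun [set: m.-tuple X]
      (fun x => (\val (M m x) : 'rV[R]_p) ord0 j).

Definition uniform_tail (P : Theta -> probability X R) (M : estimation_scheme)
    (C1 C2 gamma : R) (r : nat -> R) : Prop :=
  [/\ [/\ 0 < C1, 0 < C2 & 0 < gamma],
      forall n : nat, (1 <= n)%N -> 0 < r n,
      r n @[n --> \oo] --> +oo &
      forall (n : nat) (delta : R), (1 <= n)%N -> 0 < delta ->
        (ereal_sup (range (fun theta : Theta =>
           iid_law (P theta) n
             [set x | (delta <= norm2 (\val (M n x) - \val theta))%R]))
         <= (C1 * expR (- C2 * r n * delta `^ gamma))%:E)%E].

(* When [c t >= 0] the ceiling is a nonnegative integer and [`|_|] only casts it
   to [nat]. *)
Definition sample_size (c : nat -> R) (n t : nat) : nat :=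
  if t is 0 then n else `|Num.ceil (c t * n%:R)|%N.

Section process.
Context (d' : measure_display) (Omega : measurableType d').
Variable Pr : probability Omega R.

(* The kernel [K] is a regular conditional law of [Y] given the sigma-algebra
   generated by [G]. The measurability of [K] is part of this notion, so the
   parametric family itself need not be assumed measurable in its parameter. *)
Definition conditional_law (dT : measure_display) (T : measurableType dT)
    (G : set (set Omega)) (Y : Omega -> T) (K : Omega -> probability T R) :
    Prop :=
  forall B : set T, measurable B ->
    measurable_fun [set: g_sigma_algebraType G]
      (fun w : g_sigma_algebraType G => K w B : \bar R) /\
    forall A : set Omega, <<s G >> A ->
      Pr (A `&` Y @^-1` B) = (\int[Pr]_(w in A) K w B)%E.

(* Generators of the sigma-algebra of the first [t] datasets; it also makes the
   first [t] estimates measurable, since they are functions of these datasets. *)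
Definition past (N : nat -> nat) (D : forall t, Omega -> (N t).-tuple X)
    (t : nat) : set (set Omega) :=
  \bigcup_(s < t) preimage_set_system setT (D s) measurable.

(* The estimates are [theta_hat t] for [t >= 1]; [theta_hat 0] is unused. *)
Definition recursive_training (P : Theta -> probability X R)
    (M : estimation_scheme) (theta_star : Theta) (n : nat) (c : nat -> R)
    (D : forall t : nat, {RV Pr >-> (sample_size c n t).-tuple X})
    (theta_hat : nat -> Omega -> Theta) : Prop :=
  [/\ forall B : set (n.-tuple X), measurable B ->
        Pr (D 0 @^-1` B) = iid_law (P theta_star) n B,
      forall (t : nat) (w : Omega), theta_hat t.+1 w = M _ (D t w) &
      forall t : nat, (1 <= t)%N ->
        conditional_law (past (fun s => D s) t) (D t)
          (fun w => iid_law (P (theta_hat t w)) (sample_size c n t))].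

End process.
End training.

(* Main.v *)
(* Put u = s/2 and split delta into the telescoping step sizes
   e_t = delta ((t+1)^-u - (t+2)^-u), whose sum is at most delta. If the T-th
   estimate is at distance at least delta from theta_star, then for some t < T
   the step from parameter t to parameter t+1 has length at least e_t. The
   uniform tail bound applies to each step conditionally on the past, although
   the parameter is random. Since e_t >= delta u (t+2)^-(1+u) and the sample
   size at time t is at least c0 (t+2)^(gamma (1+s)/kappa) n, the t-th step
   fails with probability at most C1 exp(- K n^kappa (t+2)^(gamma u)), and
   exp(-y) <= (y/q)^-q with q = (1+u)/(gamma u) turns the union bound into a sum
   of terms n^(- kappa q) (t+2)^-(1+u), uniformly bounded in T by a multiple of
   n^(- kappa q). *)

Require Import Defs.
From mathcomp Require Import all_boot all_order all_algebra.
From mathcomp Require Import all_classical all_reals all_analysis measurable_realfun.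
From mathcomp Require Import ring.

Import Order.TTheory GRing.Theory Num.Theory.
Import numFieldNormedType.Exports.

Local Open Scope classical_set_scope.
Local Open Scope ring_scope.

(** * The Euclidean norm: triangle inequality and measurability of distance events *)

Section norm2.
Context {R : realType} {p : nat}.
Implicit Types x y : 'rV[R]_p.

Lemma sum_sqr_ge0 x : 0 <= \sum_(j < p) x ord0 j ^+ 2.
Proof. by apply: sumr_ge0 => j _; exact: sqr_ge0. Qed.

Lemma norm2_ge0 x : 0 <= norm2 x. Proof. exact: sqrtr_ge0. Qed.

Lemma sqr_norm2 x : norm2 x ^+ 2 = \sum_(j < p) x ord0 j ^+ 2.
Proof. by rewrite sqr_sqrtr// sum_sqr_ge0. Qed.

Lemma norm2_eq0 {x} : norm2 x = 0 -> x = 0.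
Proof.
move=> x0; have := sqr_norm2 x; rewrite x0 expr0n/= => /esym/eqP.
rewrite psumr_eq0 => [/allP xj0|j _]; last exact: sqr_ge0.
apply/rowP => j; rewrite mxE; apply/eqP.
by have := xj0 j; rewrite mem_index_enum sqrf_eq0 => /(_ isT).
Qed.

(** With [a = norm2 x] and [b = norm2 y], the squared norm of [b x - a y] expands to
    [2 a b (a b - <x, y>)]. It is nonnegative, and [2 a b] can be cancelled once the zero vectors
    are set aside. *)
Lemma norm2_CauchySchwarz x y :
  \sum_(j < p) x ord0 j * y ord0 j <= norm2 x * norm2 y.
Proof.
have [x0|x0] := eqVneq (norm2 x) 0.
  rewrite x0 mul0r (norm2_eq0 x0) big1// => j _; by rewrite mxE mul0r.
have [y0|y0] := eqVneq (norm2 y) 0.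
  rewrite y0 mulr0 (norm2_eq0 y0) big1// => j _; by rewrite mxE mulr0.
have a0 : 0 < norm2 x by rewrite lt_neqAle eq_sym x0 norm2_ge0.
have b0 : 0 < norm2 y by rewrite lt_neqAle eq_sym y0 norm2_ge0.
have : 0 <= \sum_(j < p) (norm2 y * x ord0 j - norm2 x * y ord0 j) ^+ 2.
  by apply: sumr_ge0 => j _; exact: sqr_ge0.
have -> : \sum_(j < p) (norm2 y * x ord0 j - norm2 x * y ord0 j) ^+ 2 =
    norm2 x * norm2 y * 2 *
    (norm2 x * norm2 y - \sum_(j < p) x ord0 j * y ord0 j).
  transitivity (norm2 y ^+ 2 * (\sum_(j < p) x ord0 j ^+ 2)
      - norm2 x * norm2 y * 2 * (\sum_(j < p) x ord0 j * y ord0 j)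
      + norm2 x ^+ 2 * \sum_(j < p) y ord0 j ^+ 2).
    rewrite !mulr_sumr -sumrB -big_split; apply: eq_bigr => j _ /=; ring.
  rewrite -!sqr_norm2; ring.
by rewrite pmulr_rge0 ?mulr_gt0// subr_ge0.
Qed.

Lemma norm2D x y : norm2 (x + y) <= norm2 x + norm2 y.
Proof.
rewrite -(@ler_pXn2r _ 2)// ?nnegrE ?addr_ge0 ?norm2_ge0//.
rewrite sqr_norm2 sqrrD !sqr_norm2.
under eq_bigr do rewrite mxE sqrrD.
rewrite !big_split/= lerD2r lerD2l ?mulr2n.
by apply: lerD; exact: norm2_CauchySchwarz.
Qed.

Lemma measurable_norm2_ge (d : measure_display) (T : measurableType d)
    (f g : T -> 'rV[R]_p) (e : R) :
  (forall j, measurable_fun [set: T] (fun t => f t ord0 j)) ->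
  (forall j, measurable_fun [set: T] (fun t => g t ord0 j)) ->
  measurable [set t | e <= norm2 (f t - g t)].
Proof.
move=> mf mg.
have mn : measurable_fun setT (fun t => norm2 (f t - g t)).
  apply: measurableT_comp; first exact: continuous_measurable_fun (@sqrt_continuous R).
  apply: measurable_sum => j.
  apply: measurable_funX; under eq_fun do rewrite !mxE.
  exact: measurable_funB.
have -> : [set t | e <= norm2 (f t - g t)] =
    [set: T] `&` (fun t => norm2 (f t - g t)) @^-1` `[e, +oo[%classic.
  by rewrite setTI; apply/seteqP; split => t /=; rewrite in_itv/= andbT.
exact: mn.
Qed.

End norm2.

(** * Conditional laws evaluated on sets that depend on the past *)

Section freezing.
Context {d d' : measure_display} {Omega : measurableType d}
  {T : measurableType d'} {R : realType}.
Variables (Pr : probability Omega R) (G : set (set Omega)).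
Variables (Y : {RV Pr >-> T}) (K : Omega -> probability T R).
Hypotheses (Gm : G `<=` measurable) (YK : conditional_law Pr G Y K).
Local Notation OmegaG := (g_sigma_algebraType G).
Local Open Scope ereal_scope.

Lemma measurable_id_g_sigma_algebra :
  measurable_fun [set: Omega] (id : Omega -> OmegaG).
Proof.
move=> _ A mA; rewrite setTI /=.
by apply: (smallest_sub _ Gm mA); exact: sigma_algebra_measurable.
Qed.

(* The random section [xsection S w] may be treated as frozen when conditioning
   on [G]: both sides are finite measures in [S] that agree on rectangles. *)
Lemma conditional_law_xsection (S : set (OmegaG * T)) : measurable S ->
  measurable_fun [set: Omega] (fun w => K w (xsection S w)) /\
  Pr [set w | S (w, Y w)] = \int[Pr]_w K w (xsection S w).
Proof.
pose id' : Omega -> OmegaG := id.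
have mid : measurable_fun setT id' := measurable_id_g_sigma_algebra.
have mpair : measurable_fun setT (fun w => (id' w, Y w)).
  exact: measurable_fun_pair.
have mpre A : measurable A -> measurable [set w | A (id' w, Y w)].
  by move=> mA; have := mpair measurableT A mA; rewrite setTI.
pose phi (A : set (OmegaG * T)) := fun w : Omega => K w (xsection A w).
(* Dynkin's argument: [XY] is a lambda-system containing the pi-system [C] of rectangles, which
   generates the product sigma-algebra. *)
pose XY := [set A | [/\ measurable A, measurable_fun setT (phi A) &
  Pr [set w | A (id' w, Y w)] = \int[Pr]_w phi A w]].
suff : measurable `<=` XY by move=> h /h[_ mS PS].
rewrite measurable_prod_measurableType.
set C := [set A `*` B | A in measurable & B in measurable].
have CI : setI_closed C.
  move=> _ _ [X1 mX1 [X2 mX2 <-]] [Y1 mY1 [Y2 mY2 <-]].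
  exists (X1 `&` Y1); first exact: measurableI.
  by exists (X2 `&` Y2); [exact: measurableI|rewrite setXI].
have CXY : C `<=` XY.
  move=> _ [A mA [B mB <-]].
  have [mKB PrKB] := YK _ mB.
  have mKB' : measurable_fun setT (fun w : Omega => K w B).
    exact: measurableT_comp mKB mid.
  have mA' : measurable (A : set Omega).
    by have := mid measurableT A mA; rewrite setTI.
  (* On a rectangle the section is [B] or empty, according to whether [w] lies in [A], so the claim
     is the defining identity of the conditional law. *)
  have phiE : phi (A `*` B) = (fun w => K w B) \_ A.
    apply/funext => w; rewrite /phi patchE.
    case: ifPn => wA; first by rewrite in_xsectionX.
    by rewrite notin_xsectionX// measure0.
  split; first exact: measurableX.
    rewrite phiE; apply/(measurable_restrictT _ _).1 => //.
    exact: measurable_funTS.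
  by rewrite phiE -integral_mkcond -PrKB.
have sub A B w : A `<=` B -> xsection A w `<=` @xsection OmegaG T B w.
  by move=> AB; exact: le_xsection.
suff : lambda_system setT XY by move=> h; exact: lambda_system_subset.
split => //.
- by apply: CXY; exists setT => //; exists setT => //; rewrite setXTT.
- move=> A B BA [mA mphiA PA] [mB mphiB PB].
  have mAB : measurable (A `\` B) by exact: measurableD.
  have phiD w : phi A w = phi (A `\` B) w + phi B w.
    rewrite /phi -measureU ?setDKU//; [|exact: measurable_xsection..|].
      by rewrite xsectionD setDKU//; exact: sub.
    by rewrite xsectionD setDKI.
  have phiB : phi (A `\` B) = phi A \- phi B.
    by apply/funext => w; rewrite phiD addeK// /phi fin_num_measure//;
      exact: measurable_xsection.
  have mphi : measurable_fun setT (phi (A `\` B)).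
    by rewrite phiB; exact: emeasurable_funB.
  have finB : Pr [set w | B (id' w, Y w)] \is a fin_num.
    by rewrite fin_num_measure//; exact: mpre.
  (* Adding and subtracting the finite mass of [B] turns the difference into additivity of [Pr] and
     of the integral. *)
  split => //; rewrite -[LHS](addeK _ finB) -[RHS](addeK _ finB).
  congr (_ - _); rewrite [in RHS]PB -ge0_integralD//; [|by []..].
  under [RHS]eq_integral do rewrite -phiD.
  rewrite -PA -measureU//; [| exact: mpre.. |].
    congr (Pr _); apply/seteqP; split => w /=; first by move=> [[]//|/BA].
    by move=> ?; have [?|?] := pselect (B (id' w, Y w)); [right|left].
  by apply/seteqP; split => w //= -[[]].
(* Increasing unions: continuity from below of [Pr] and of each [K w], then monotone convergence and
   uniqueness of limits. *)
- move=> F ndF XYF.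
  have mF n : measurable (F n) by have [] := XYF n.
  have mUF : measurable (\bigcup_n F n) by exact: bigcup_measurable.
  have phicvg w : phi (F n) w @[n --> \oo] --> phi (\bigcup_n F n) w.
    rewrite /phi xsection_bigcup; apply: nondecreasing_cvg_mu.
    - by move=> n; exact: measurable_xsection.
    - by apply: bigcup_measurable => n _; exact: measurable_xsection.
    - by move=> m n mn; apply/subsetPset/sub/subsetPset/ndF.
  split => //.
    apply: (emeasurable_fun_cvg (fun n => phi (F n))) => [n|w _]; last exact: phicvg.
    by have [] := XYF n.
  have Prcvg : Pr [set w | F n (id' w, Y w)] @[n --> \oo] -->
      Pr [set w | (\bigcup_n F n) (id' w, Y w)].
    rewrite (_ : [set w | (\bigcup_n F n) (id' w, Y w)] =
      \bigcup_n [set w | F n (id' w, Y w)])//.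
    apply: nondecreasing_cvg_mu => [n||m n mn].
    - exact: mpre.
    - by apply: bigcup_measurable => n _; exact: mpre.
    - by apply/subsetPset => w /=; move/subsetPset: (ndF _ _ mn); apply.
  have Intcvg : \int[Pr]_w phi (F n) w @[n --> \oo] -->
      \int[Pr]_w limn (fun n => phi (F n) w).
    apply: cvg_monotone_convergence => //.
    - by move=> n; have [] := XYF n.
    - move=> w _ m n mn; apply: le_measure; rewrite ?inE;
        [exact: measurable_xsection..|].
      by apply: sub; apply/subsetPset/ndF.
  have -> : (fun w => phi (\bigcup_n F n) w) = (fun w => limn (fun n => phi (F n) w)).
    by apply/funext => w; apply/esym/cvg_lim => //; exact: phicvg.
  apply: (cvg_unique _ Prcvg) => //.
  rewrite (_ : (fun n => _) = (fun n => \int[Pr]_w phi (F n) w))//.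
  by apply/funext => n; have [] := XYF n.
Qed.

End freezing.

(** * Estimates for the step sizes, the sample sizes and the sum of the tails *)

Section real_estimates.
Context {R : realType}.
Implicit Types x y q u : R.

Lemma powR_le_neg x y q : 0 <= q -> 0 < x -> x <= y -> y `^ (- q) <= x `^ (- q).
Proof.
move=> q0 x0 xy; rewrite !powRN lef_pV2 ?posrE ?powR_gt0 ?(lt_le_trans x0)//.
by rewrite ge0_ler_powR// nnegrE ltW// (lt_le_trans x0).
Qed.

(** Write [exp(-y) = exp(y/q)^(-q)] and use [exp(y/q) >= 1 + y/q >= y/q]. *)
Lemma expRN_le_powR y q : 0 < y -> 0 < q -> expR (- y) <= (y / q) `^ (- q).
Proof.
move=> y0 q0.
have -> : - y = y / q * - q by rewrite mulrN divfK// gt_eqF.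
rewrite expRM powR_le_neg ?divr_gt0//; first exact: ltW.
by apply: le_trans (expR_ge1Dx _); rewrite lerDr.
Qed.

Definition weight u (t : nat) : R := t.+1%:R `^ (- u) - t.+2%:R `^ (- u).

Lemma sum_weight_le1 u (T : nat) : \sum_(t < T) weight u t <= 1.
Proof.
rewrite -(big_mkord xpredT (weight u)) /weight.
rewrite (@telescope_sumr_eq _ 0 T (fun t => - t.+1%:R `^ (- u)))//.
  by rewrite opprK addrC powR1 gerBl powR_ge0.
by move=> t _; rewrite opprK addrC.
Qed.

(** With [x = t+1] and [y = t+2], factoring out [y^(-u)] leaves [(y/x)^u - 1 >= u/y]. This follows
    from [exp z >= 1 + z] used twice: [(y/x)^u >= 1 + u ln(y/x)] and [ln(y/x) >= 1 - x/y = 1/y]. *)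
Lemma weight_ge u (t : nat) : 0 < u -> u * t.+2%:R `^ (- (1 + u)) <= weight u t.
Proof.
move=> u0; set y : R := t.+2%:R; set x : R := t.+1%:R.
have x0 : 0 < x by rewrite ltr0n.
have y0 : 0 < y by rewrite ltr0n.
have yx : y = x + 1 by rewrite /y /x -[in LHS]natr1.
have -> : weight u t = y `^ (- u) * ((y / x) `^ u - 1).
  rewrite /weight -/x -/y powRM ?invr_ge0 ?ltW// mulrBr mulr1 mulrA -powRD.
    by rewrite addNr powRr0 mul1r -powR_inv1 ?ltW// -powRrM mulN1r.
  by rewrite (gt_eqF y0) implybT.
rewrite opprD addrC powRD ?(gt_eqF y0) ?implybT// powR_inv1 ?(ltW y0)//.
rewrite mulrCA.
rewrite ler_wpM2l ?powR_ge0//.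
rewrite -[y / x]lnK ?posrE ?divr_gt0// -expRM lerBrDl.
apply: le_trans (expR_ge1Dx _); rewrite lerD2l mulrC ler_wpM2r ?(ltW u0)//.
rewrite -[y / x]invrK lnV ?posrE ?invr_gt0 ?divr_gt0// invf_div lerNr.
apply: (@le_trans _ _ (x / y - 1)).
  rewrite lerBrDl -[leRHS]lnK ?posrE ?divr_gt0//; exact: expR_ge1Dx.
have x1 : x + 1 != 0 by rewrite -yx gt_eqF.
by rewrite yx le_eqVlt; apply/orP; left; apply/eqP; field.
Qed.

Lemma sample_size_ge (c : nat -> R) (alpha : R) : 0 <= alpha ->
  asymp c (fun t => t%:R `^ alpha) ->
  exists2 c0 : R, 0 < c0 &
    forall n t, c0 * t.+2%:R `^ alpha * n%:R <= (sample_size c n t)%:R.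
Proof.
move=> alpha0 [c1 [C [c10 _ ccC]]].
(* The first entry serves time 0, where the size is [n] and the base is 2; the second serves
   [t >= 1], where [t + 2 <= 3 t]. *)
exists (Num.min (2%:R `^ (- alpha)) (c1 * 3%:R `^ (- alpha))).
  by rewrite lt_min mulr_gt0 ?powR_gt0.
move=> n [|t] /=.
  rewrite ler_piMl//.
  apply: (@le_trans _ _ (2%:R `^ (- alpha) * 2%:R `^ alpha)).
    by rewrite ler_wpM2r ?powR_ge0// ge_min lexx.
  by rewrite -powRD ?pnatr_eq0 ?implybT// addNr powRr0.
have [ct _] := ccC t.+1 isT.
have le_ct : Num.min (2%:R `^ (- alpha)) (c1 * 3%:R `^ (- alpha)) *
    t.+3%:R `^ alpha <= c t.+1.
  apply: le_trans ct.
  apply: (@le_trans _ _ (c1 * 3%:R `^ (- alpha) * t.+3%:R `^ alpha)).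
    by rewrite ler_wpM2r ?powR_ge0// ge_min lexx orbT.
  rewrite -mulrA ler_wpM2l ?(ltW c10)//.
  rewrite powRN -powR_inv1 ?powR_ge0// powRAC -powRM ?powR_ge0// powR_inv1//.
  rewrite ge0_ler_powR ?nnegrE ?mulr_ge0 ?invr_ge0//.
  rewrite mulrC ler_pdivrMr// -natrM ler_nat.
  by rewrite mulSn -[t.+3]/(3 + t)%N leq_add2l leq_pmulr.
apply: (@le_trans _ _ (c t.+1 * n%:R)); first by rewrite ler_wpM2r.
apply: le_trans (ceil_ge _) _.
have := ler_norm (Num.ceil (c t.+1 * n%:R)).
by rewrite -abszE -(ler_int R) -pmulrn.
Qed.

(** [B] and [rho] are chosen before [n] and [T]; this uniformity lets [T] go to infinity first. *)
Lemma step_tails_sum (C1 C2 gamma kappa s delta : R) (c : nat -> R) :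
  0 < C1 -> 0 < C2 -> 0 < gamma -> 0 < kappa -> 0 < s -> 0 < delta ->
  asymp c (fun t => t%:R `^ (gamma * (1 + s) / kappa)) ->
  exists B rho : R, 0 < rho /\ forall n T : nat, (0 < n)%N ->
    \sum_(t < T) (C1 * expR (- C2 * (sample_size c n t)%:R `^ kappa *
      (delta * weight (s / 2) t) `^ gamma)) <= B * n%:R `^ (- rho).
Proof.
move=> C10 C20 g0 k0 s0 d0 casymp.
have a0 : 0 <= gamma * (1 + s) / kappa.
  by rewrite divr_ge0 ?mulr_ge0 ?addr_ge0 ?ltW.
have [c0 c00 c0le] := sample_size_ge _ _ a0 casymp.
set u := s / 2; have u0 : 0 < u by rewrite divr_gt0.
have sE : s = u * 2 by rewrite divfK.
clearbody u.
(* This [q] turns [tau^(gamma u)] into [tau^(-(1+u))], the order of the lower bound on [weight]. *)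
set q := (1 + u) / (gamma * u).
have q0 : 0 < q by rewrite divr_gt0 ?addr_gt0 ?mulr_gt0.
have qE : gamma * u * q = 1 + u by rewrite mulrC divfK// gt_eqF// mulr_gt0.
clearbody q.
set K := C2 * c0 `^ kappa * (delta * u) `^ gamma.
have K0 : 0 < K by rewrite !mulr_gt0 ?powR_gt0 ?mulr_gt0.
have KE : K = C2 * c0 `^ kappa * (delta * u) `^ gamma by [].
clearbody K.
exists (C1 * (K / q) `^ (- q) / u), (kappa * q); split; first exact: mulr_gt0.
move=> n T n0; have nR0 : 0 < n%:R :> R by rewrite ltr0n.
(* Each tail is compared with a multiple of [weight u t], so the telescoping sum also bounds the
   series of tails. *)
apply: (@le_trans _ _ (\sum_(t < T)
    (C1 * (K / q) `^ (- q) / u * n%:R `^ (- (kappa * q)) * weight u t))); last first.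
  rewrite -mulr_sumr ler_piMr ?sum_weight_le1// !mulr_ge0 ?invr_ge0 ?powR_ge0//.
    exact: ltW.
  exact: ltW.
apply: ler_sum => t _.
rewrite -!mulrA ler_wpM2l ?(ltW C10)//.
set tau : R := t.+2%:R; have tau0 : 0 < tau by rewrite ltr0n.
have yK : K * n%:R `^ kappa * tau `^ (gamma * u) <=
    C2 * (sample_size c n t)%:R `^ kappa * (delta * weight u t) `^ gamma.
  have -> : K * n%:R `^ kappa * tau `^ (gamma * u) =
      C2 * (c0 * tau `^ (gamma * (1 + s) / kappa) * n%:R) `^ kappa *
      (delta * (u * tau `^ (- (1 + u)))) `^ gamma.
    rewrite [delta * (u * _)]mulrA !powRM ?mulr_ge0 ?powR_ge0 ?ltW//.
    rewrite -!powRrM divfK ?gt_eqF// KE powRM ?ltW//.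
    (* The sample size contributes [gamma (1+s)] and the step size [-gamma (1+u)]; with [s = 2 u]
       the sum is [gamma u > 0]. *)
    have -> : tau `^ (gamma * u) =
        tau `^ (gamma * (1 + s)) * tau `^ (- (1 + u) * gamma).
      rewrite -powRD ?(gt_eqF tau0) ?implybT//; congr (_ `^ _).
      by rewrite sE; ring.
    ring.
  rewrite ler_pM ?mulr_ge0 ?powR_ge0 ?(ltW C20)//.
    rewrite ler_wpM2l ?(ltW C20)// ge0_ler_powR ?(ltW k0)// ?nnegrE//.
      by rewrite !mulr_ge0 ?powR_ge0 ?(ltW c00).
    exact: c0le.
  have uw := weight_ge u t u0.
  rewrite ge0_ler_powR ?(ltW g0)// ?nnegrE.
  - by rewrite !mulr_ge0 ?powR_ge0 ?ltW.
  - by rewrite mulr_ge0 ?(ltW d0)// (le_trans _ uw)// mulr_ge0 ?powR_ge0 ?ltW.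
  - by rewrite ler_wpM2l ?(ltW d0).
rewrite !mulNr.
have y0 : 0 < K * n%:R `^ kappa * tau `^ (gamma * u) by rewrite !mulr_gt0 ?powR_gt0.
apply: (@le_trans _ _ (expR (- (K * n%:R `^ kappa * tau `^ (gamma * u))))).
  by rewrite ler_expR lerN2 !mulrA in yK *.
apply: le_trans (expRN_le_powR _ _ y0 q0) _.
have -> : K * n%:R `^ kappa * tau `^ (gamma * u) / q =
    K / q * n%:R `^ kappa * tau `^ (gamma * u) by ring.
have Kq0 : 0 <= K / q by rewrite divr_ge0 ?ltW.
rewrite powRM; [|by rewrite mulr_ge0 ?powR_ge0|exact: powR_ge0].
rewrite powRM ?powR_ge0//.
rewrite -!powRrM -mulrA ler_wpM2l ?powR_ge0// mulrN [leRHS]mulrCA ler_wpM2l ?powR_ge0//.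
have -> : gamma * u * - q = - (1 + u).
  by rewrite mulrN qE.
by rewrite ler_pdivlMl// weight_ge.
Qed.

End real_estimates.

(** * Tail bounds along the recursive training process *)

Section training.
Context {R : realType} {d : measure_display} {X : measurableType d} {p : nat}
  {Theta : set 'rV[R]_p} {P : Theta -> probability X R}
  {M : estimation_scheme X Theta}.
Variables (C1 C2 gamma : R) (r : nat -> R).
Hypotheses (mM : measurable_scheme M) (tail : uniform_tail P M C1 C2 gamma r).
Context {d' : measure_display} {Omega : measurableType d'}
  {Pr : probability Omega R} {theta_star : Theta} {n : nat} {c : nat -> R}.
Variables (D : forall t : nat, {RV Pr >-> (sample_size c n t).-tuple X})
  (theta_hat : nat -> Omega -> Theta).
Hypothesis training : recursive_training P M theta_star D theta_hat.

(* The parameter the [t]-th dataset is drawn from; [theta_hat 0] is arbitrary. *)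
Definition data_parameter (t : nat) (w : Omega) : Theta :=
  if t is 0 then theta_star else theta_hat t w.

Lemma measurable_data_parameter (t : nat) (j : 'I_p) :
  measurable_fun [set: Omega] (fun w => (\val (data_parameter t w) : 'rV_p) ord0 j).
Proof.
case: training => _ hatE _; case: t => [|t] /=; first exact: measurable_cst.
under eq_fun do rewrite hatE.
apply: (measurableT_comp (mM (sample_size c n t) j)).
exact: measurable_funPT.
Qed.

(** The parameter at time [t+1] is a function of dataset [t], which belongs to the past of time
    [t+1]; hence conditioning on that past may freeze it. *)
Lemma measurable_data_parameter_past (t : nat) (j : 'I_p) :
  measurable_fun [set: g_sigma_algebraType (past (fun s => D s) t)]
    (fun w => (\val (data_parameter t w) : 'rV_p) ord0 j).
Proof.
case: training => _ hatE _; case: t => [|t] /=; first exact: measurable_cst.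
under eq_fun do rewrite hatE.
apply: (measurableT_comp (mM (sample_size c n t) j)).
move=> _ B mB; apply: sub_sigma_algebra.
by exists t => //=; exists B.
Qed.

Lemma past_measurable (t : nat) : past (fun s => D s) t `<=` measurable.
Proof. by move=> _ [s _ [B mB <-]]; exact: measurable_funPT. Qed.

Lemma training_step_tail (t : nat) (e : R) : 0 < e ->
  (1 <= sample_size c n t)%N ->
  (Pr [set w | (e <= norm2 (\val (data_parameter t.+1 w) - \val (data_parameter t w)))%R]
   <= (C1 * expR (- C2 * r (sample_size c n t) * e `^ gamma))%:E)%E.
Proof.
move=> e0 nt; case: tail => -[C10 _ _] _ _ tailP; case: (training) => D0 hatE DP.
set b := (C1 * _)%:E.
have tailT theta : (iid_law (P theta) (sample_size c n t)
    [set x | (e <= norm2 (\val (M _ x) - \val theta))%R] <= b)%E.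
  apply: le_trans (tailP _ _ nt e0).
  by apply: ereal_sup_ubound; exists theta.
have -> : [set w | e <= norm2 (\val (data_parameter t.+1 w) - \val (data_parameter t w))] =
    [set w | e <= norm2 (\val (M _ (D t w)) - \val (data_parameter t w))].
  by apply/funext => w /=; rewrite hatE.
(* At time 0 the parameter is deterministic and the law of [D 0] is given unconditionally. *)
case: t => [|t] in nt b tailT *.
  rewrite -[X in Pr X]/(D 0%N @^-1` [set x | e <= norm2 (\val (M _ x) - \val theta_star)]).
  rewrite D0; first exact: tailT.
  by apply: measurable_norm2_ge => j; [exact: mM|exact: measurable_cst].
pose G := past (fun s => D s) t.+1.
pose S : set (g_sigma_algebraType G * (sample_size c n t.+1).-tuple X) :=
  [set z | e <= norm2 (\val (M _ z.2) - \val (data_parameter t.+1 z.1))].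
have mS : measurable S.
  apply: measurable_norm2_ge => j; first exact: measurableT_comp (mM _ j) _.
  exact: (measurableT_comp (measurable_data_parameter_past t.+1 j)).
rewrite -[X in Pr X]/[set w | S (w, D t.+1 w)].
have [mKS ->] := conditional_law_xsection Pr G (D t.+1) _ (past_measurable t.+1)
  (DP t.+1 isT) S mS.
(* For each [w] the section of [S] is the tail event at the fixed parameter [theta_hat t.+1 w], so
   the integrand is at most [b]. *)
apply: (@le_trans _ _ (\int[Pr]_(w in setT) cst b w)%E); last first.
  by rewrite integral_cst//= (probability_setT Pr) mule1.
apply: ge0_le_integral => //.
move=> w _; apply: le_trans (tailT (theta_hat t.+1 w)).
by rewrite xsectionE.
Qed.

(** Induction on [T]: by the triangle inequality, either the earlier estimate is already at distance
    at least the partial sum, or the last step is at least its own [e]; then a union bound. *)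
Lemma training_tail (e : nat -> R) (T : nat) :
  (forall t, 0 < e t) -> (forall t, (1 <= sample_size c n t)%N) ->
  (Pr [set w | (\sum_(t < T.+1) e t <=
        norm2 (\val (theta_hat T.+1 w) - \val theta_star))%R]
   <= (\sum_(t < T.+1)
         (C1 * expR (- C2 * r (sample_size c n t) * e t `^ gamma)))%:E)%E.
Proof.
move=> e0 nt; rewrite -[theta_hat T.+1]/(data_parameter T.+1).
elim: T => [|T IHT].
  by rewrite !big_ord1; exact: training_step_tail.
have mE t' t (a : R) : measurable [set w | a <=
    norm2 (\val (data_parameter t' w) - \val (data_parameter t w))].
  by apply: measurable_norm2_ge => j; exact: measurable_data_parameter.
rewrite big_ord_recr [in leRHS]big_ord_recr EFinD /=.
have step := training_step_tail T.+1 (e T.+1) (e0 _) (nt _).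
apply: le_trans (leeD IHT step).
rewrite -[theta_hat T.+2]/(data_parameter T.+2).
apply: le_trans (measureU2 _ _ _); [|exact: (mE T.+1 0%N)|exact: mE].
apply: le_measure; rewrite ?inE; [exact: (mE T.+2 0%N)| |].
  by apply: measurableU; [exact: (mE T.+1 0%N)|exact: mE].
move=> w /= le_w; apply/orP; rewrite -[_ || _]negbK negb_or -!ltNge.
apply/negP => /andP[lt1 lt2].
have := le_lt_trans (norm2D _ _) (ltrD lt2 lt1).
by rewrite subrKA [ltRHS]addrC ltNge le_w.
Qed.

End training.

(** * The limits in [T] and in [n] *)

Lemma limn_esup_le {R : realType} (u : (\bar R)^nat) (b : \bar R) :
  (forall T, u T.+1 <= b)%E -> (limn_esup u <= b)%E.
Proof.
move=> ub; apply: ge_ereal_inf; exists (ereal_sup (u @` [set T | (1 <= T)%N])).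
  by exists [set T | (1 <= T)%N] => //; exact: nbhs_infty_ge.
by apply: ge_ereal_sup => _ [[//|T] _ <-].
Qed.

Lemma cvg_powR_negn {R : realType} (rho : R) : 0 < rho ->
  n%:R `^ (- rho) @[n --> \oo] --> (0 : R).
Proof.
move=> rho0; under eq_fun do rewrite powRN.
apply/gtr0_cvgV0.
  by near=> n; rewrite powR_gt0// ltr0n; near: n; exact: nbhs_infty_gt.
apply/cvgryPge => A; near=> n.
have [A0|A0] := leP A 0; first by rewrite (le_trans A0)// powR_ge0.
have -> : A = (A `^ rho^-1) `^ rho.
  by rewrite -powRrM mulVf ?gt_eqF// powRr1 ?ltW.
rewrite ge0_ler_powR ?(ltW rho0)// ?nnegrE ?powR_ge0//.
near: n; exact: nbhs_infty_ger.
Unshelve. all: by end_near. Qed.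

(** The inner limit is expressed by a limit superior, which always exists and equals the limit
    whenever there is one. Each [n] has its own probability space. *)
Theorem corollary1 (R : realType) (d : measure_display) (X : measurableType d)
    (p : nat) (Theta : set 'rV[R]_p) (P : Theta -> probability X R)
    (M : estimation_scheme X Theta) (mM : measurable_scheme M)
    (C1 C2 gamma kappa s : R) (kappa_gt0 : 0 < kappa) (s_gt0 : 0 < s)
    (tail : uniform_tail P M C1 C2 gamma (fun n : nat => n%:R `^ kappa))
    (c : nat -> R)
    (c_asymp : asymp c (fun t : nat => t%:R `^ (gamma * (1 + s) / kappa)))
    (theta_star : Theta)
    (d' : nat -> measure_display) (Omega : forall n : nat, measurableType (d' n))
    (Pr : forall n : nat, probability (Omega n) R)
    (D : forall n t : nat, {RV (Pr n) >-> (sample_size c n t).-tuple X})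
    (theta_hat : forall n : nat, nat -> Omega n -> Theta)
    (training : forall n : nat, (1 <= n)%N ->
       recursive_training P M theta_star (D n) (theta_hat n)) :
  forall delta : R, 0 < delta ->
    limn_esup (fun T : nat =>
      Pr n [set w | delta <= norm2 (\val (theta_hat n T w) - \val theta_star)])
    @[n --> \oo] --> 0%E.
Proof.
move=> delta delta0.
have [[C10 C20 g0] _ _ _] := tail.
have [B [rho [rho0 leB]]] :=
  step_tails_sum _ _ _ _ _ _ _ C10 C20 g0 kappa_gt0 s_gt0 delta0 c_asymp.
have a0 : 0 <= gamma * (1 + s) / kappa.
  by rewrite divr_ge0 ?mulr_ge0 ?addr_ge0 ?ltW.
have [c0 c00 c0le] := sample_size_ge _ _ a0 c_asymp.
have B0 : (B * n%:R `^ (- rho))%:E @[n --> \oo] --> 0%E.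
  apply/cvg_EFin; first exact: nearW.
  by rewrite -(mulr0 B); apply: cvgMr; exact: cvg_powR_negn.
apply: (squeeze_cvge _ (cvg_cst 0%E) B0); near=> n.
have n0 : (1 <= n)%N by near: n; exact: nbhs_infty_ge.
apply/andP; split.
  by apply: limf_esup_ge0 => //; exact: filter_not_empty.
apply: limn_esup_le => T.
(* The tail assumption applies to nonempty datasets only; a positive lower bound on a natural number
   gives at least 1. *)
have nt t : (1 <= sample_size c n t)%N.
  rewrite -(ltr_nat R); apply: lt_le_trans (c0le n t).
  by rewrite !mulr_gt0 ?powR_gt0 ?ltr0n.
pose e t := delta * weight (s / 2) t.
have e0 t : 0 < e t.
  by rewrite mulr_gt0// (lt_le_trans _ (weight_ge _ _ _))// ?mulr_gt0 ?powR_gt0 ?divr_gt0.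
apply: le_trans (_ : _ <= (\sum_(t < T.+1) (C1 * expR (- C2 *
  (sample_size c n t)%:R `^ kappa * e t `^ gamma)))%:E)%E _; last by rewrite lee_fin leB.
apply: le_trans (training_tail _ _ _ _ mM tail _ _ (training n n0) e T e0 nt).
have mE (a : R) : measurable [set w | a <=
    norm2 (\val (theta_hat n T.+1 w) - \val theta_star)].
  apply: measurable_norm2_ge => j; last exact: measurable_cst.
  exact: (measurable_data_parameter mM _ _ (training n n0) T.+1).
(* The step sizes add up to at most [delta], so the event with threshold [delta] lies in the one
   with their sum as threshold. *)
apply: le_measure; rewrite ?inE//.
move=> w /=; apply: le_trans.
by rewrite -mulr_sumr ler_piMr ?sum_weight_le1// ltW.
Unshelve. all: by end_near. Qed.
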